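(* Let $\mathbb{F}$ be a field with $\operatorname{char}(\mathbb{F})\ne 2$, let $n\ge 2$, let $\mathcal{A}$ be a unital associative algebra over $\mathbb{Z}[1/2]$, and let $\phi:M_n(\mathbb{F})^+\to\mathcal{A}^+$ be Jordan multiplicative. Set $e:=\phi(0)$ and $\psi:=\phi-e$ (i.e. $\psi(X)=\phi(X)-e$). Then $e$ is an idempotent and $\psi$ takes its values in the associative corner $(1-e)\mathcal{A}(1-e)$. Moreover, set $p:=\psi(I_n)$. Then there exists an idempotent $f$ in the associative subring of $p\mathcal{A}p$ generated by $\psi(M_n(\mathbb{F}))$, central in that subring, such that the map $$\theta:M_n(\mathbb{F})\to f\mathcal{A}f,\qquad \theta(X):=f\psi(X),$$ is a unital ring homomorphism, the map $$\eta:M_n(\mathbb{F})\to(p-f)\mathcal{A}(p-f),\qquad \eta(X):=(p-f)\psi(X),$$ is a unital ring antihomomorphism, and $\psi=\theta+\eta$. Consequently, $\phi=e+\theta+\eta$.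
   Context: $\mathbb{Z}[1/2]$ is the ring of dyadic rationals. For an associative $\mathbb{Z}[1/2]$-algebra $\mathcal{A}$, $\mathcal{A}^+$ denotes the same additive group with the product $x\circ y:=\frac12(xy+yx)$; in particular $M_n(\mathbb{F})^+$ is $M_n(\mathbb{F})$ with $X\circ Y=\frac12(XY+YX)$. A map $\phi:M_n(\mathbb{F})^+\to\mathcal{A}^+$ is Jordan multiplicative if $\phi(X\circ Y)=\phi(X)\circ\phi(Y)$ for all $X,Y$ (no additivity is assumed). For an idempotent $q\in\mathcal{A}$, the corner $q\mathcal{A}q$ is regarded as an associative ring with identity $q$ (possibly the zero ring), and ''unital'' for maps into corners means $\theta(I_n)=f$ and $\eta(I_n)=p-f$. A ring antihomomorphism is an additive map $\eta$ with $\eta(XY)=\eta(Y)\eta(X)$. $I_n$ is the identity matrix. *)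

(* Defs.v *)
From HB Require Import structures.
From mathcomp Require Import all_boot all_order all_algebra.
From mathcomp Require Import classical_sets.

Set Implicit Arguments.
Unset Strict Implicit.
Unset Printing Implicit Defensive.

Import Order.TTheory GRing.Theory Num.Theory.
Local Open Scope ring_scope.
Local Open Scope classical_set_scope.

(* Elements of Z[1/2], as rationals whose reduced denominator is a power of 2. *)
Definition is_dyadic : {pred rat} := fun x => 2%N.-nat `|denq x|%N.

Lemma is_dyadicP (x : rat) :
  reflect (exists k (m : int), x = m%:~R / 2 ^+ k) (x \in is_dyadic).
Proof.
apply: (iffP idP) => [|[k [m ->]]]; rewrite unfold_in.
  move=> x2; exists (logn 2 `|denq x|%N), (numq x).
  rewrite -[LHS]divq_num_den; congr (_ / _).
  rewrite -[LHS]/((denq x)%:~R) -absz_denq -{1}(part_pnat_id x2) p_part.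
  by rewrite -natrX.
set y := _ / _.
have yE : (numq y * 2 ^+ k = m * denq y)%R.
  apply: (@intr_inj rat); rewrite !rmorphM /= numqE mulrAC; congr (_ * _).
  by rewrite rmorphXn /= /y divfK // expf_neq0.
apply: (@pnat_dvd _ (2 ^ k)%N); last by rewrite pnatX pnat_id.
rewrite -(Gauss_dvdr _ (n := `|numq y|%N)) 1?coprime_sym ?coprime_num_den //.
have -> : (`|numq y| * 2 ^ k)%N = `|(numq y * 2 ^+ k)%R|%N.
  by rewrite abszM abszX.
by rewrite yE abszM dvdn_mull.
Qed.

Lemma is_dyadic_subring : subring_closed is_dyadic.
Proof.
split=> [|_ _ /is_dyadicP[k [m ->]] /is_dyadicP[l [q ->]]
         |_ _ /is_dyadicP[k [m ->]] /is_dyadicP[l [q ->]]]; apply/is_dyadicP.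
- by exists 0%N, 1; rewrite expr0 divr1.
- exists (k + l)%N, (m * 2 ^+ l - q * 2 ^+ k).
  have nz j : (2 ^+ j : rat) != 0 by rewrite expf_neq0.
  rewrite rmorphB !rmorphM !rmorphXn exprD mulrBl.
  congr (_ - _); last first.
    by rewrite mulrC [q%:~R * _]mulrC -mulf_div divff // mul1r mulrC.
  by rewrite -mulf_div divff // mulr1.
- exists (k + l)%N, (m * q).
  by rewrite rmorphM /= exprD invfM mulrACA.
Qed.

HB.instance Definition _ := GRing.isSubringClosed.Build rat is_dyadic
  is_dyadic_subring.

Record dyadic := Dyadic { dyadic_val :> rat; _ : dyadic_val \in is_dyadic }.
HB.instance Definition _ := [isSub for dyadic_val].
HB.instance Definition _ := [Choice of dyadic by <:].
HB.instance Definition _ := [SubChoice_isSubComNzRing of dyadic by <:].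

Lemma half_is_dyadic : 2^-1 \in is_dyadic.
Proof. by []. Qed.

Definition half : dyadic := Dyadic half_is_dyadic.

Definition mx_jordan (F : fieldType) (n : nat) (X Y : 'M[F]_n) : 'M[F]_n :=
  2^-1 *: (X *m Y + Y *m X).

(* A Z[1/2]-algebra is given by a ring and its central structure morphism. The
   library's [algType] is not used because it excludes the zero algebra. *)
Definition central_morphism (R S : pzRingType) (sigma : {rmorphism R -> S}) :=
  forall r x, sigma r * x = x * sigma r.

Definition alg_jordan (A : pzRingType) (sigma : {rmorphism dyadic -> A})
  (x y : A) : A := sigma half * (x * y + y * x).

Definition jordan_multiplicative (F : fieldType) (n : nat) (A : pzRingType)
    (sigma : {rmorphism dyadic -> A}) (phi : 'M[F]_n -> A) :=
  forall X Y, phi (mx_jordan X Y) = alg_jordan sigma (phi X) (phi Y).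

Definition is_idempotent (A : pzRingType) (q : A) := q * q = q.

Definition corner (A : pzRingType) (q : A) : set A :=
  [set q * a * q | a in [set: A]].

(* Subrings of the corner [q A q] contain its identity [q]. *)
Definition corner_subring (A : pzRingType) (q : A) (B : set A) :=
  [/\ B `<=` corner q,
      B q,
      forall x y, B x -> B y -> B (x - y)
    & forall x y, B x -> B y -> B (x * y)].

Definition corner_generated (A : pzRingType) (q : A) (S : set A) : set A :=
  smallest (corner_subring q) S.

Definition corner_hom (R A : pzRingType) (q : A) (theta : R -> A) :=
  [/\ forall x, corner q (theta x),
      {morph theta : x y / x + y},
      {morph theta : x y / x * y}
    & theta 1 = q].

Definition corner_antihom (R A : pzRingType) (q : A) (eta : R -> A) :=
  [/\ forall x, corner q (eta x),
      {morph eta : x y / x + y},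
      forall x y, eta (x * y) = eta y * eta x
    & eta 1 = q].

(* Main.v *)
Require Import Defs.
From HB Require Import structures.
From mathcomp Require Import all_boot all_order all_algebra.
From mathcomp Require Import ring.
Import GRing.Theory.
Local Open Scope ring_scope.

(**
  Put [psi X = phi X - phi 0]. The elements [g_i = psi E_ii] are orthogonal
  idempotents.  They add up to [p = psi 1]: the defect [a = p - \sum_i g_i]
  annihilates [psi X] for every 0-1 diagonal matrix [X], by induction on the
  rank, so [a = a p = 0].  Hence [psi X] is determined by its Peirce components
  [g_k psi(X) g_l], each of which depends only on the entries [X k l] and
  [X l k]; off the diagonal, additivity follows from expanding
  [psi ((1 + X) o (1 + Y))], and on the diagonal by multiplying with the image
  of [E_ij + E_ji].

  Once [psi] is additive, [psi (x E_ij)] is the sum of a part in [g_i A g_j] and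
  a part in [g_j A g_i].  The first parts multiply like matrix units, the second
  ones in the reverse order, and the products that would mix them vanish.  So
  [f = \sum_i g_i psi(E_ij) g_j psi(E_ji) g_i], for any choice of indices
  [j != i], is the central idempotent cutting out the homomorphic part; passing
  to the converse ring replaces [f] by [p - f], which gives the
  antihomomorphic part.
*)

(** * Idempotents and Jordan products *)

Section TorsionFree.
Variables (A : pzRingType) (A2 : forall x : A, x *+ 2 = 0 -> x = 0).
Implicit Types g x y : A.

Lemma mulr2n_inj x y : x *+ 2 = y *+ 2 -> x = y.
Proof.
by move=> xy; apply/eqP; rewrite -subr_eq0; apply/eqP/A2; rewrite mulrnBl xy subrr.
Qed.

(** Multiplying [x g = - g x] by [g] on the left and on the right gives both [g x g = - g x] and
    [g x g = g x], so [2 g x = 0]. *)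
Lemma idem_jordan0 g x : g * g = g -> g * x + x * g = 0 -> g * x = 0 /\ x * g = 0.
Proof.
move=> gg gx; have xg : x * g = - (g * x) by apply/eqP; rewrite -addr_eq0 addrC gx.
suff g0 : g * x = 0 by rewrite xg g0 oppr0.
have gxg : g * x * g = - (g * x) by rewrite -mulrA xg mulrN mulrA gg.
have gxg' : g * x * g = g * x.
  by apply/oppr_inj; rewrite -mulNr -xg -mulrA gg xg.
by apply: A2; rewrite mulr2n -{1}gxg' gxg addNr.
Qed.

Lemma idem_jordan1 g x :
  g * g = g -> g * x + x * g = x *+ 2 -> g * x = x /\ x * g = x.
Proof.
move=> gg gx.
have e1 : g * x * g = g * x.
  move: (congr1 ( *%R g) gx).
  by rewrite mulrDr mulrnAr !mulrA gg mulr2n => /addrI.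
have e2 : g * x * g = x * g.
  move: (congr1 ( *%R^~ g) gx).
  by rewrite mulrDl mulrnAl -!mulrA gg mulr2n => /addIr.
have e3 : x * g = g * x by rewrite -e1 -e2.
by split; apply: mulr2n_inj; rewrite -gx ?e3 mulr2n.
Qed.

End TorsionFree.

(** * Scaled matrix units and diagonal matrices *)

Section MatrixUnits.
Variables (F : fieldType) (n : nat).
Implicit Types (i j k l : 'I_n) (x y : F) (X Y : 'M[F]_n).

Definition dg (d : 'I_n -> F) : 'M[F]_n := diag_mx (\row_i d i).
Definition mxunit i j x : 'M[F]_n := x *: delta_mx i j.

Lemma dgE d k l : dg d k l = d k *+ (k == l).
Proof. by rewrite !mxE. Qed.

Lemma mxunitE i j x k l : mxunit i j x k l = x *+ ((k == i) && (l == j)).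
Proof. by rewrite !mxE mulr_natr. Qed.

Lemma mul_dgE d X k l : (dg d * X) k l = d k * X k l.
Proof. by rewrite -mulmxE mul_diag_mx !mxE. Qed.

Lemma mul_dgrE d X k l : (X * dg d) k l = X k l * d l.
Proof. by rewrite -mulmxE mul_mx_diag !mxE. Qed.

Lemma mxunitM i j x k l y :
  mxunit i j x * mxunit k l y = mxunit i l (x * y *+ (j == k)).
Proof.
rewrite /mxunit -mulmxE -scalemxAl -scalemxAr scalerA mul_delta_mx_cond.
by rewrite -scalerMnr -scalerMnl.
Qed.

Lemma mxunit0 i j : mxunit i j 0 = 0.
Proof. by rewrite /mxunit scale0r. Qed.

Lemma mxunitD i j x y : mxunit i j (x + y) = mxunit i j x + mxunit i j y.
Proof. by rewrite /mxunit scalerDl. Qed.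

Lemma mxunit_dg i x : mxunit i i x = dg (fun k => x *+ (k == i)).
Proof.
apply/matrixP=> k l; rewrite mxunitE dgE.
by case: (eqVneq k i) => [->|_]; rewrite ?mul0rn //= eq_sym.
Qed.

Lemma mul_mxunitl i x X k l : (mxunit i i x * X) k l = x * X k l *+ (k == i).
Proof. by rewrite mxunit_dg mul_dgE mulrnAl. Qed.

Lemma mul_mxunitr i x X k l : (X * mxunit i i x) k l = X k l * x *+ (l == i).
Proof. by rewrite mxunit_dg mul_dgrE mulrnAr. Qed.

End MatrixUnits.

(** * Jordan multiplicative maps vanishing at 0 *)

Section JordanMap.
Variables (F : fieldType) (char_neq2 : 2%N \notin [pchar F]).
Variable n : nat.
Variables (A : pzRingType) (A2 : forall x : A, x *+ 2 = 0 -> x = 0).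
Variable psi : 'M[F]_n -> A.
Hypothesis psi0 : psi 0 = 0.
Hypothesis psiJ : forall X Y W, X * Y + Y * X = W *+ 2 ->
  psi X * psi Y + psi Y * psi X = psi W *+ 2.
Implicit Types (i j k l : 'I_n) (x y : F) (X Y W : 'M[F]_n).

Let p := psi 1.
Let E i j x : 'M[F]_n := mxunit F n i j x.
Let g i := psi (E i i 1).
Let jo X Y : 'M[F]_n := mx_jordan X Y.
Let r2 := @mulr2n_inj A A2.

Lemma two_neq0 : (2 : F) != 0.
Proof. by move: char_neq2; rewrite inE /=. Qed.

Lemma jordan_mx2 X Y : X * Y + Y * X = jo X Y *+ 2.
Proof.
rewrite /jo /mx_jordan -scaler_nat scalerA divff ?two_neq0 // scale1r.
by rewrite !mulmxE.
Qed.

Lemma mulr2n_mx_inj X Y : X *+ 2 = Y *+ 2 -> X = Y.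
Proof.
rewrite -!scaler_nat => /(congr1 (fun Z => 2^-1 *: Z)).
by rewrite !scalerA mulVf ?two_neq0 // !scale1r.
Qed.

Lemma jordan_def X Y W : X * Y + Y * X = W *+ 2 -> jo X Y = W.
Proof. by rewrite jordan_mx2 => /mulr2n_mx_inj. Qed.

Lemma psi_jo X Y : psi X * psi Y + psi Y * psi X = psi (jo X Y) *+ 2.
Proof. exact/psiJ/jordan_mx2. Qed.

Lemma joE i X k l :
  jo (E i i 1) X k l = 2^-1 * (X k l *+ ((k == i) + (l == i))).
Proof.
by rewrite /jo /mx_jordan mxE !mulmxE mxE mul_mxunitl mul_mxunitr mul1r mulr1 mulrnDr.
Qed.

Lemma psi1_unit X : p * psi X = psi X /\ psi X * p = psi X.
Proof.
apply: idem_jordan1 => //.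
  by apply: r2; rewrite {1}mulr2n; apply: psiJ; rewrite mulr1 mulr2n.
by apply: psiJ; rewrite mul1r mulr1 mulr2n.
Qed.

Let pl X : p * psi X = psi X := (psi1_unit X).1.
Let pr X : psi X * p = psi X := (psi1_unit X).2.

Lemma g_idem i : g i * g i = g i.
Proof.
apply: r2; rewrite mulr2n; apply: psiJ.
by rewrite mxunitM eqxx mulr1 mulr2n.
Qed.

Lemma g_orth i j : i != j -> g i * g j = 0.
Proof.
move=> ij; apply: (proj1 (idem_jordan0 _ A2 _ _ (g_idem i) _)).
rewrite -[RHS](mul0rn _ 2) -psi0; apply: psiJ.
by rewrite !mxunitM [j == i]eq_sym (negPf ij) !mulr0n !mxunit0 addr0 mul0rn.
Qed.

(** * The images of the diagonal matrix units add up to the image of 1 *)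

Section Defect.
(* [a] turns out to be [0], because the matrices killed by [a] include the
   identity. A Jordan product of a killed matrix with an arbitrary one need not
   a priori be killed; [killed_peirce] gives a criterion, which lets the rank
   grow starting from the [E i i 1]. *)
Variable a : A.
Hypothesis aE : a + \sum_i g i = p.
Let N X := a * psi X = 0 /\ psi X * a = 0.

Lemma defect_g i : a * g i = 0 /\ g i * a = 0.
Proof.
rewrite -[a](addrK (\sum_i g i)) aE mulrBl mulrBr pl pr mulr_suml mulr_sumr.
rewrite (bigD1 i) //= big1 => [|j ji]; last by rewrite g_orth.
rewrite (bigD1 i) //= big1 => [|j ji]; last by rewrite g_orth // eq_sym.
by rewrite g_idem addr0 subrr.
Qed.

Let ag i := (defect_g i).1.
Let ga i := (defect_g i).2.

Lemma defect_mul_split X : a * psi X = a * psi X * a + \sum_i a * psi X * g i.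
Proof.
by rewrite -mulr_sumr -!mulrDr aE -mulrA pr.
Qed.

Lemma mul_defect_split X : psi X * a = a * psi X * a + \sum_i g i * (psi X * a).
Proof.
by rewrite -mulr_suml -mulrA -mulrDl aE mulrA pl.
Qed.

Lemma defect_jo i X : a * psi X * g i = a * psi (jo (E i i 1) X) *+ 2 /\
  g i * (psi X * a) = psi (jo (E i i 1) X) * a *+ 2.
Proof.
split.
  by rewrite -mulrnAr -psi_jo mulrDr !mulrA ag mul0r add0r.
by rewrite -mulrnAl -psi_jo mulrDl -!mulrA ga mulr0 addr0.
Qed.

(** The component [a psi(X o Y) a] vanishes because [X] is killed; the others, [a psi(X o Y) g_i]
    and [g_i psi(X o Y) a], come from [E_ii o (X o Y)] by [defect_jo]. *)
Lemma killed_peirce X Y : N X -> (forall i, N (jo (E i i 1) (jo X Y))) ->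
  N (jo X Y).
Proof.
move=> [X1 X2] XY.
have a0 : a * psi (jo X Y) * a = 0.
  apply: A2; rewrite -mulrnAl -mulrnAr -psi_jo mulrDr mulrDl.
  rewrite !mulrA X1 !mul0r add0r.
  by rewrite -mulrA X2 mulr0.
split; rewrite (defect_mul_split, mul_defect_split) a0 add0r big1 // => i _.
  by rewrite (defect_jo _ _).1 (XY i).1 mul0rn.
by rewrite (defect_jo _ _).2 (XY i).2 mul0rn.
Qed.

Lemma killed0 : N 0.
Proof. by rewrite /N psi0 mulr0 mul0r. Qed.

(** Such a matrix [X] equals [4 E_jj o (E_ii o X)], so applying [defect_jo] twice produces a factor
    [g_i g_j = 0] or [g_j g_i = 0]. *)
Lemma killed_off i j x y : i != j -> N (E i j x + E j i y).
Proof.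
move=> ij; set X := E i j x + _.
have -> : X = jo (E j j 1) (jo (E i i 1) (X *+ 4)).
  apply/matrixP=> k l; rewrite !joE !mxE.
  have F2 := two_neq0.
  case: (eqVneq k i) => [ki|_]; case: (eqVneq l i) => [li|_];
    case: (eqVneq k j) => [kj|_]; case: (eqVneq l j) => [lj|_] /=;
    by [field | subst; rewrite eqxx in ij].
split; apply: A2.
  rewrite -(defect_jo _ _).1; apply: A2; rewrite -mulrnAl -(defect_jo _ _).1.
  by rewrite -mulrA g_orth ?mulr0.
rewrite -(defect_jo _ _).2; apply: A2; rewrite -mulrnAr -(defect_jo _ _).2.
by rewrite mulrA g_orth ?mul0r // eq_sym.
Qed.

Lemma killed_unit i : N (E i i 1).
Proof. by rewrite /N ag ga. Qed.

Lemma jo_dgE d X k l : jo (dg F n d) X k l = 2^-1 * ((d k + d l) * X k l).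
Proof.
by rewrite /jo /mx_jordan mxE !mulmxE mxE mul_dgE mul_dgrE [X k l * _]mulrC -mulrDl.
Qed.

Let q (S : {set 'I_n}) := dg F n (fun k => (k \in S)%:R).

Lemma jo_unit_q k (S : {set 'I_n}) :
  jo (E k k 1) (q S) = if k \in S then E k k 1 else 0.
Proof.
have F2 := two_neq0.
apply/matrixP=> m l; rewrite joE dgE (fun_if (fun M : 'M_n => M m l)) mxunitE mxE.
have [<-|ml] := eqVneq m l; last first.
  rewrite mulr0n mul0rn mulr0; have [mk|_] /= := eqVneq m k; last by case: ifP.
  by rewrite -mk eq_sym (negPf ml) mulr0n; case: ifP.
rewrite mulr1n andbb; have [->|_] := eqVneq m k; last first.
  by rewrite mulr0n mulr0; case: ifP.
by case: (k \in S) => /=; field.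
Qed.

Local Ltac cases_on i j S k l :=
  case: (k =P i) => ?; case: (l =P i) => ?; try (exfalso; congruence);
  case: (k =P j) => ?; case: (l =P j) => ?; try (exfalso; congruence);
  case: (k =P l) => ?; try (exfalso; congruence);
  let kS := fresh in case kS: (k \in S); try (exfalso; congruence);
  let lS := fresh in case lS: (l \in S); try (exfalso; congruence);
  rewrite /=; by field.

(* With [r] the projection onto [S :\ i] and [u x = x (E_ij + E_ji)], the
   product of [q S] and [r + u 1] is [r + u 2^-1], and the product of the latter
   with [r + u 2] is [q (j |: S)]. *)
Lemma killed_q_step (S : {set 'I_n}) i j :
  i \in S -> j \notin S -> N (q S) -> N (q (j |: S)).
Proof.
move=> iS jS NS; have ij : i != j by apply: contraNneq jS => <-.
have F2 := two_neq0.
have ij' : i <> j by exact/eqP.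
have iS' : (i \in S) = true := iS; have jS' := negPf jS.
pose r := q (S :\ i); pose u x := E i j x + E j i x.
have rE k l : r k l = ((k != i) && (k \in S))%:R *+ (k == l).
  by rewrite /r dgE in_setD1.
have uE x k l : u x k l = x *+ ((k == i) && (l == j)) + x *+ ((k == j) && (l == i)).
  by rewrite mxE !mxunitE.
have WE : jo (q S) (r + u 1) = r + u 2^-1.
  apply/matrixP=> k l; rewrite jo_dgE [LHS]/= mxE rE uE mxE rE uE.
  by cases_on i j S k l.
have NW : N (r + u 2^-1).
  rewrite -WE; apply: (killed_peirce _ _ NS) => k; rewrite WE.
  have [kij|] := boolP ((k == i) || (k == j)).
    have -> : jo (E k k 1) (r + u 2^-1) = u (2^-1 * 2^-1); last exact: killed_off.
    apply/matrixP=> m l; rewrite joE mxE rE !uE.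
    by case/orP: kij => /eqP->; cases_on i j S m l.
  rewrite negb_or => /andP[ki kj].
  have -> : jo (E k k 1) (r + u 2^-1) = if k \in S then E k k 1 else 0.
    apply/matrixP=> m l; rewrite joE mxE rE uE (fun_if (fun M : 'M_n => M m l)).
    rewrite mxunitE mxE; move/eqP: ki; move/eqP: kj => kj ki.
    by case: (m =P k) => [mk|mk]; case: (l =P k) => [lk|lk]; case: ifP => kS;
      cases_on i j S m l.
  by case: ifP => _; [exact: killed_unit | exact: killed0].
have ru x : r * u x = 0.
  apply/matrixP=> k l; rewrite mul_dgE uE mxE in_setD1.
  by cases_on i j S k l.
have ur x : u x * r = 0.
  apply/matrixP=> k l; rewrite mul_dgrE uE mxE in_setD1.
  by cases_on i j S k l.
have uu x y : u x * u y = E i i (x * y) + E j j (x * y).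
  rewrite mulrDl !mulrDr !mxunitM !eqxx eq_sym (negPf ij) !mulr0n !mxunit0.
  by rewrite addr0 add0r.
(* The weights 1/2 and 2 are mutually inverse, so [u 2^-1] times [u 2] is [E_ii + E_jj]: this
   restores [i] and adds [j]. *)
have QE : jo (r + u 2^-1) (r + u 2) = q (j |: S).
  apply: jordan_def; clearbody u.
  rewrite !mulrDl !mulrDr !ru !ur !uu !addr0 !add0r mulVf // divff // -mulr2n.
  congr (_ *+ 2); apply/matrixP=> k l; rewrite mxE mul_dgE rE !dgE in_setU1 in_setD1.
  rewrite mxE !mxunitE.
  by cases_on i j S k l.
rewrite -QE; apply: (killed_peirce _ _ NW) => k; rewrite QE.
have -> : jo (E k k 1) (q (j |: S)) = if k \in j |: S then E k k 1 else 0.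
  exact: jo_unit_q.
by case: ifP => _; [exact: killed_unit | exact: killed0].
Qed.

(** Induction on a bound for the rank; singletons are a base case of their own, since
    [killed_q_step] needs an index already present. *)
Lemma killed_q (S : {set 'I_n}) : N (q S).
Proof.
move: {2}#|S| (leqnn #|S|) => m; elim: m S => [|m IHm] S.
  rewrite leqn0 cards_eq0 => /eqP->.
  suff -> : q set0 = 0 by exact: killed0.
  by apply/matrixP=> k l; rewrite dgE inE mxE mul0rn.
move=> Sm; have [->|[j jS]] := set_0Vmem S; first by apply: IHm; rewrite cards0.
have Sjm : (#|S :\ j| <= m)%N by rewrite -ltnS (leq_trans _ Sm) // (cardsD1 j S) jS.
have NSj := IHm _ Sjm; have [S0|[i iS]] := set_0Vmem (S :\ j).
  rewrite -(setD1K jS) S0 setU0.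
  suff -> : q [set j] = E j j 1 by exact: killed_unit.
  by apply/matrixP=> k l; rewrite dgE in_set1 /E mxunit_dg dgE.
by rewrite -(setD1K jS); apply: (killed_q_step _ i) => //; rewrite !inE eqxx.
Qed.

Lemma defect_eq0 : a = 0.
Proof.
have q1 : q setT = 1.
  by apply/matrixP=> k l; rewrite dgE inE (_ : 1 = 1%:M) // mxE.
have ap : a * p = 0 by have := killed_q setT; rewrite q1 => -[].
rewrite -ap -[a in RHS](addrK (\sum_i g i)) aE mulrBl pr mulr_suml.
by under eq_bigr do rewrite pr; rewrite -[X in _ = X - _]aE addrK.
Qed.

End Defect.

Lemma sum_g : \sum_i g i = p.
Proof.
have := defect_eq0 (p - \sum_i g i); rewrite addrNK => /(_ erefl) /eqP.
by rewrite subr_eq0 => /eqP.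
Qed.

Hypothesis n_ge2 : (2 <= n)%N.

(** * Peirce components and additivity *)

Let c k l X := g k * psi X * g l.

Lemma g_mul k l : g k * g l = g k *+ (k == l).
Proof. by case: eqVneq => [->|/g_orth]; rewrite ?g_idem. Qed.

Lemma g_mul_c k l X : g k * c k l X = c k l X.
Proof. by rewrite /c !mulrA g_idem. Qed.

Lemma c_mul_g k l X : c k l X * g l = c k l X.
Proof. by rewrite /c -!mulrA g_idem. Qed.

Lemma psi_sum X : psi X = \sum_k \sum_l c k l X.
Proof.
under eq_bigr do rewrite -mulr_sumr sum_g -mulrA pr.
by rewrite -mulr_suml sum_g pl.
Qed.

Lemma c_mul k l X Y :
  g k * (psi X * psi Y) * g l = \sum_m c k m X * c m l Y.
Proof.
rewrite -{1}[psi X]pr -sum_g mulr_sumr !mulr_suml mulr_sumr mulr_suml.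
by apply: eq_bigr => m _; rewrite /c -{1}(g_idem m) !mulrA.
Qed.

Lemma c_jo k l X Y :
  c k l (jo X Y) *+ 2 = \sum_m (c k m X * c m l Y + c k m Y * c m l X).
Proof.
rewrite big_split /= -!c_mul -mulrDl -mulrDr psi_jo.
by rewrite mulrnAr mulrnAl.
Qed.

Lemma c_peirce i k l X :
  c k l (jo (E i i 1) X) *+ 2 = c k l X *+ ((k == i) + (l == i)).
Proof.
rewrite /c -mulrnAl -mulrnAr -psi_jo mulrDr mulrDl mulrnDr mulrA g_mul !mulrnAl.
congr (_ + _); rewrite -!mulrA g_mul eq_sym.
by case: eqVneq => [->|_]; rewrite ?mulr1n // !mulr0n !mulr0.
Qed.

Lemma c_zero k l : c k l 0 = 0.
Proof. by rewrite /c psi0 mulr0 mul0r. Qed.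

(** The operation [E_jj o (E_ii o _)] erases all entries but those at [(i, j)] and [(j, i)], while
    it merely divides [c i j] by 4. *)
Lemma c_off_eq i j X Y : i != j -> X i j = Y i j -> X j i = Y j i ->
  c i j X = c i j Y.
Proof.
move=> ij Xij Xji.
have cE Z : c i j Z = c i j (jo (E j j 1) (jo (E i i 1) Z)) *+ 2 *+ 2.
  by rewrite c_peirce (negPf ij) eqxx c_peirce eqxx eq_sym (negPf ij).
rewrite cE [RHS]cE; congr (c i j _ *+ 2 *+ 2).
apply/matrixP=> k l; rewrite !joE.
case: (k =P i) => [->|ki]; case: (l =P i) => [->|li];
  rewrite ?(negPf ij) ?mulr0n ?mulr0 ?mulr1n //.
  by case: eqP => [->|_]; rewrite ?Xij ?mulr0n ?mulr0.
by case: eqP => [->|_]; rewrite ?Xji ?mulr0n ?mulr0.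
Qed.

(** * Images of the matrices [E_ij + E_ji] *)

Section Swap.
Variables (i j : 'I_n) (ij : i != j).
Let u := E i j 1 + E j i 1.

Lemma swapE k l : u k l = ((k == i) && (l == j) || (k == j) && (l == i))%:R.
Proof.
rewrite mxE !mxunitE.
case: (k =P i) => ki; case: (l =P j) => lj; case: (k =P j) => kj; case: (l =P i) => li;
  rewrite /= ?addr0 ?add0r //.
by move: ij; rewrite -ki -kj eqxx.
Qed.

Lemma mul_swap X l : (u * X) i l = X j l.
Proof.
rewrite -mulmxE mxE (bigD1 j) //= big1 => [|k kj]; rewrite swapE !eqxx.
  by rewrite mul1r addr0.
by rewrite (negPf ij) (negPf kj) mul0r.
Qed.

Lemma mul_swapr X k : (X * u) k i = X k j.
Proof.
rewrite -mulmxE mxE (bigD1 j) //= big1 => [|l lj]; rewrite swapE !eqxx.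
  by rewrite orbT mulr1 addr0.
by rewrite (negPf lj) (negPf ij) andbF mulr0.
Qed.

(** Here [E_ii o u = E_jj o u], but on [c i i] the first product acts as the identity and the second
    as 0. *)
Lemma c_swap_diag : c i i u = 0.
Proof.
apply: A2; have -> : c i i u *+ 2 = c i i (jo (E i i 1) u) *+ 2.
  by rewrite c_peirce eqxx.
suff -> : jo (E i i 1) u = jo (E j j 1) u by rewrite c_peirce (negPf ij).
apply/matrixP=> k l; rewrite !joE swapE.
case: (k =P i) => ki; case: (l =P i) => li; case: (k =P j) => kj;
  case: (l =P j) => lj; rewrite /= ?mul0rn //; by case/eqP: ij; congruence.
Qed.

Lemma c_swap_row k : k != j -> c i k u = 0.
Proof.
move=> kj; have [->|ki] := eqVneq k i; first exact: c_swap_diag.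
rewrite -(c_zero i k); apply: c_off_eq; first by rewrite eq_sym.
  by rewrite swapE mxE (negPf kj) (negPf ij) andbF.
by rewrite swapE mxE (negPf kj) (negPf ki).
Qed.

End Swap.

(* The index [1] if [i = 0], and [0] otherwise. *)
Definition ord_other i : 'I_n := Ordinal (leq_ltn_trans (leq_b1 (val i == 0)%N) n_ge2).

Lemma ord_other_neq i : ord_other i != i.
Proof. by apply/eqP=> /(congr1 val) /=; case: (val i) => [|[]]. Qed.

Let swap i j : 'M[F]_n := E i j 1 + E j i 1.

Lemma swapC i j : swap i j = swap j i.
Proof. exact: addrC. Qed.

Lemma joXE X Y k l : jo X Y k l = 2^-1 * ((X * Y) k l + (Y * X) k l).
Proof. by rewrite /jo /mx_jordan mxE !mulmxE mxE. Qed.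

(** This carries the diagonal entry [X i i] to off-diagonal positions, where [c_off_eq] applies. *)
Lemma jo_swap_corner i j X : i != j ->
  jo (swap i j) (jo (E i i 1) X) i j = 2^-1 * X i i /\
  jo (swap i j) (jo (E i i 1) X) j i = 2^-1 * X i i.
Proof.
move=> ij; have F2 := two_neq0; have ji : j != i by rewrite eq_sym.
set X' := jo (E i i 1) X.
have Xi : X' i i = X i i by rewrite joE eqxx /=; field.
have Xj : X' j j = 0 by rewrite joE (negPf ji) mulr0n mulr0.
rewrite !joXE; split.
  by rewrite mul_swap // swapC mul_swapr // Xj Xi add0r.
by rewrite mul_swapr // swapC mul_swap // Xj Xi addr0.
Qed.

(** The square of the swap is [E_ii + E_jj], whose [(i, i)] component is [g i]; expanding the square
    leaves one product, since the swap has no other component in row [i]. *)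
Lemma c_swap_mul i j : i != j -> c i j (swap i j) * c j i (swap i j) = g i.
Proof.
move=> ij; have ji : j != i by rewrite eq_sym.
have e : c i i (jo (swap i j) (swap i j)) = c i j (swap i j) * c j i (swap i j).
  apply: r2; rewrite c_jo (bigD1 j) //= big1 ?addr0 ?mulr2n // => k kj.
  by rewrite c_swap_row // mul0r addr0.
rewrite -e; apply: r2; rewrite [RHS](_ : _ = c i i (jo (E i i 1) (E i i 1)) *+ 2); last first.
  rewrite c_peirce eqxx /c -!mulrA !g_idem //.
suff -> : jo (swap i j) (swap i j) = E i i 1 + E j j 1.
  have := c_peirce i i i (E i i 1 + E j j 1); rewrite eqxx => <-.
  rewrite (jordan_def (E i i 1) (E i i 1) (E i i 1)) ?mulr2n ?mxunitM ?eqxx ?mulr1 //.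
  rewrite (jordan_def _ _ (E i i 1)) // mulrDr mulrDl !mxunitM !eqxx (negPf ij).
  by rewrite (negPf ji) !mulr0n !mxunit0 !addr0 mulr1 mulr2n.
apply: jordan_def; rewrite -mulr2n; congr (_ *+ 2).
rewrite mulrDl !mulrDr !mxunitM !eqxx (negPf ij) (negPf ji) !mulr0n !mxunit0 mulr1.
by rewrite addr0 add0r.
Qed.

(** In the expansion of [c i j] on the right only [c i i X] times [c i j (swap i j)] remains, and
    [c_swap_mul] cancels the second factor. *)
Lemma c_diagE i j X : i != j ->
  c i i X = (c i j (jo (swap i j) (jo (E i i 1) X)) *+ 2) * c j i (swap i j).
Proof.
move=> ij; have ji : j != i by rewrite eq_sym.
have cX : c i i (jo (E i i 1) X) = c i i X by apply: r2; rewrite c_peirce eqxx.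
have cj0 : c j j (jo (E i i 1) X) = 0.
  by apply: A2; rewrite c_peirce (negPf ji).
rewrite c_jo big_split /= (bigD1 j) //= big1 => [|k kj]; last first.
  by rewrite c_swap_row // mul0r.
rewrite cj0 mulr0 add0r (bigD1 i) //= big1 => [|k ki]; last first.
  rewrite [swap i j]addrC [c k j _](_ : _ = 0) ?mulr0 //.
  have [->|kj] := eqVneq k j; first exact: c_swap_diag.
  rewrite -(c_zero k j); apply: c_off_eq => //; rewrite swapE // mxE.
    by rewrite (negPf ki) (negPf kj).
  by rewrite (negPf ki) (negPf kj) !andbF.
by rewrite add0r addr0 cX -mulrA c_swap_mul // c_mul_g.
Qed.

Lemma c_eq k l X Y : X k l = Y k l -> X l k = Y l k -> c k l X = c k l Y.
Proof.
have [->{k} XY _|kl] := eqVneq k l; last exact: c_off_eq.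
have lj : l != ord_other l by rewrite eq_sym ord_other_neq.
rewrite (c_diagE _ _ X lj) (c_diagE _ _ Y lj); congr (_ *+ 2 * _).
have [Xi Xj] := jo_swap_corner _ _ X lj; have [Yi Yj] := jo_swap_corner _ _ Y lj.
by apply: c_off_eq; rewrite // ?Xi ?Xj ?Yi ?Yj XY.
Qed.

Lemma c_eq0 k l X : X k l = 0 -> X l k = 0 -> c k l X = 0.
Proof. by move=> X0 X0'; rewrite -(c_zero k l); apply: c_eq; rewrite mxE. Qed.

Let off i j x y : 'M[F]_n := E i j x + E j i y.

Lemma offE i j x y k l : i != j ->
  off i j x y k l = if (k == i) && (l == j) then x else
                    if (k == j) && (l == i) then y else 0.
Proof.
move=> ij; rewrite mxE !mxunitE.
case: (k =P i) => ki; case: (l =P j) => lj; case: (k =P j) => kj;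
  case: (l =P i) => li; rewrite /= ?addr0 ?add0r //; by case/eqP: ij; congruence.
Qed.

(* Additivity comes from (1 + X) o (1 + Y) = 1 + X + Y + X o Y: if X and Y live in
   the (i, j) and (j, i) entries then X o Y is diagonal, hence invisible to c i j. *)
Lemma c_offD i j X Y : i != j -> c i j (X + Y) = c i j X + c i j Y.
Proof.
move=> ij; have ji : j != i by rewrite eq_sym.
have oneE k l : (1 : 'M[F]_n) k l = (k == l)%:R by rewrite (_ : 1 = 1%:M) // mxE.
have addE (Z1 Z2 : 'M[F]_n) k l : (Z1 + Z2) k l = Z1 k l + Z2 k l by rewrite mxE.
have off_diag0 k x y : off i j x y k k = 0.
  rewrite offE //; case: (k =P i) => [->|_]; first by rewrite (negPf ij).
  by case: eqP.
have c_diag k x y : c k k (1 + off i j x y) = g k.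
  rewrite (c_eq k k _ 1); first by rewrite /c pr g_idem.
    by rewrite addE off_diag0 addr0.
  by rewrite addE off_diag0 addr0.
have c_ij x y (Z : 'M[F]_n) : x = Z i j -> y = Z j i -> c i j (1 + off i j x y) = c i j Z.
  move=> -> ->; apply: c_off_eq => //.
    by rewrite addE oneE offE // (negPf ij) !eqxx /= add0r.
  by rewrite addE oneE offE // (negPf ji) !eqxx /= add0r.
pose X' := off i j (X i j) (X j i); pose Y' := off i j (Y i j) (Y j i).
(* The diagonal components of [1 + off] are the [g k], so only [m = i] and [m = j] contribute, each
   giving one of the two summands. *)
have halfsum x1 y1 x2 y2 : \sum_m c i m (1 + off i j x1 y1) * c m j (1 + off i j x2 y2) =
    c i j (1 + off i j x1 y1) + c i j (1 + off i j x2 y2).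
  rewrite (bigD1 i) //= (bigD1 j) //= big1 => [|k /andP[ki kj]].
    by rewrite !c_diag g_mul_c c_mul_g addr0 addrC.
  rewrite [c i k _]c_eq0 ?mul0r // addE oneE offE // ?(negPf ki) ?(negPf kj) ?andbF /=.
    by rewrite eq_sym (negPf ki) addr0.
  by rewrite addr0.
have -> : c i j (X + Y) = c i j (jo (1 + X') (1 + Y')).
  have XY' U V : jo (1 + U) (1 + V) = (1 + U + V) + jo U V.
    apply: jordan_def; rewrite mulrnDl -jordan_mx2 !mulrDl !mulrDr !mulr1 !mul1r mulr2n.
    by rewrite (AC ((2*2)*(2*2)) (((1*3*2)*(5*6*7))*(4*8))).
  have XY0 x y x' y' : off i j x y * off i j x' y' = E i i (x * y') + E j j (y * x').
    rewrite mulrDl !mulrDr !mxunitM !eqxx (negPf ij) (negPf ji) !mulr0n !mxunit0.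
    by rewrite addr0 add0r.
  have jXY k l : k != l -> jo X' Y' k l = 0.
    move=> kl; rewrite joXE !XY0 /E !mxunit_dg !addE !dgE (negPf kl) !mulr0n.
    by rewrite !addr0 mulr0.
  apply: c_off_eq; rewrite // XY' (addE X Y) (addE _ (jo X' Y')) jXY // addr0
    (addE _ Y') (addE 1 X') oneE /X' /Y' !offE // !eqxx ?(negPf ij) ?(negPf ji) ?andbF /=.
    by rewrite add0r.
  by rewrite add0r.
apply: r2; rewrite c_jo big_split /= !halfsum /X' /Y' (c_ij _ _ X) // (c_ij _ _ Y) //.
by rewrite mulr2n [c i j Y + _]addrC.
Qed.

Lemma jo_addr X Y W : jo X (Y + W) = jo X Y + jo X W.
Proof.
apply: jordan_def; rewrite mulrnDl -!jordan_mx2 mulrDr mulrDl.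
by rewrite (AC (2*2) ((1*3)*(2*4))).
Qed.

Lemma cD k l X Y : c k l (X + Y) = c k l X + c k l Y.
Proof.
have [->{k}|kl] := eqVneq k l; last exact: c_offD.
have lj : l != ord_other l by rewrite eq_sym ord_other_neq.
rewrite !(c_diagE l (ord_other l)) // -mulrDl -mulrnDl -c_offD //; congr (c _ _ _ *+ 2 * _).
by rewrite !jo_addr.
Qed.

Lemma psiD X Y : psi (X + Y) = psi X + psi Y.
Proof.
rewrite !psi_sum -big_split; apply: eq_bigr => k _ /=.
by rewrite -big_split; apply: eq_bigr => l _ /=; rewrite cD.
Qed.

(** * The homomorphic part *)

Lemma c_unit0 k l i j x :
  ~~ ((k == i) && (l == j)) -> ~~ ((k == j) && (l == i)) -> c k l (E i j x) = 0.
Proof.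
move=> /negPf kl /negPf lk; apply: c_eq0; rewrite mxunitE ?kl // andbC.
by rewrite lk.
Qed.

Lemma c_antimul k l X Y :
  c k l (X * Y + Y * X) = \sum_m (c k m X * c m l Y + c k m Y * c m l X).
Proof. by rewrite jordan_mx2 [jo _ _ *+ 2]mulr2n cD -mulr2n c_jo. Qed.

(* The homomorphic and the antihomomorphic part of [psi (E i j x)]. *)
Let a i j x := c i j (E i j x).
Let b i j x := c j i (E i j x).

Lemma c_row0 k m l x : l != m -> c k l (E k m x) = 0 /\ c k l (E m k x) = 0.
Proof.
move=> lm; split; apply: c_unit0; rewrite ?(negPf lm) ?andbF //;
  by apply: contraNN lm => /andP[/eqP<- /eqP->].
Qed.

(** This disposes of the wrongly ordered half of [c_antimul] for [E_km] and [E_ml]: if [m' = k] the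
    first factor is zero, otherwise the second. *)
Lemma c_skew0 k m l m' x y : k != l -> c k m' (E m l y) * c m' l (E k m x) = 0.
Proof.
move=> kl; have lk : l != k by rewrite eq_sym.
have [->|m'k] := eqVneq m' k.
  rewrite c_unit0 ?mul0r ?(negPf kl) ?andbF //.
rewrite [c m' l _]c_unit0 ?mulr0 ?(negPf m'k) ?(negPf lk) ?andbF //.
Qed.

Lemma c_skew0' k m l m' x y : k != l -> c l m' (E k m x) * c m' k (E m l y) = 0.
Proof.
move=> kl; have lk : l != k by rewrite eq_sym.
have [->|m'k] := eqVneq m' k.
  by rewrite [c k k _]c_unit0 ?mulr0 ?(negPf kl) ?andbF.
by rewrite c_unit0 ?mul0r ?(negPf m'k) ?(negPf lk) ?andbF.
Qed.

Lemma mxunit_antimul k m l x y : k != l ->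
  E k m x * E m l y + E m l y * E k m x = E k l (x * y).
Proof.
by move=> kl; rewrite !mxunitM eqxx [l == k]eq_sym (negPf kl) mulr0n mxunit0 addr0.
Qed.

(** For [k != l] the anticommutator of the two units is a single unit; in its expansion by
    [c_antimul] only the middle index [m] survives, in the given order. *)
Lemma a_mul k m l x y : k != l -> a k m x * a m l y = a k l (x * y).
Proof.
move=> kl; rewrite /a -(mxunit_antimul _ m) // c_antimul (bigD1 m) //= big1 => [|m' m'm].
  by rewrite c_skew0 // !addr0.
by rewrite c_skew0 // (c_row0 k m m' x m'm).1 mul0r addr0.
Qed.

Lemma b_mul k m l x y : k != l -> b m l y * b k m x = b k l (x * y).
Proof.
move=> kl; rewrite /b -(mxunit_antimul _ m) // c_antimul (bigD1 m) //= big1 => [|m' m'm].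
  by rewrite c_skew0' // add0r addr0.
by rewrite c_skew0' // (c_row0 l m m' y m'm).2 mul0r addr0.
Qed.

(** Both orders contribute here, since the anticommutator is a multiple of [E_kk + E_mm]: on the
    diagonal the homomorphic and antihomomorphic parts meet. *)
Lemma diag_mul k m x y : k != m ->
  a k k (x * y) = a k m x * a m k y + b m k y * b k m x.
Proof.
move=> km; have mk : m != k by rewrite eq_sym.
have <- : c k k (E k m x * E m k y + E m k y * E k m x) = a k k (x * y).
  by rewrite !mxunitM !eqxx cD [c k k (E m m _)]c_unit0 ?addr0 // (negPf km).
rewrite c_antimul (bigD1 m) //= big1 ?addr0 // => m' m'm.
by rewrite (c_row0 k m m' x m'm).1 (c_row0 k m m' y m'm).2 !mul0r addr0.
Qed.

(** As [E_ij] squares to zero, the coefficients 1 are settled; [a_mul] and [b_mul] pull general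
    scalars out into diagonal factors. *)
Lemma a_mul_b i j x y : i != j -> a i j x * b i j y = 0.
Proof.
move=> ij; have ab1 : a i j 1 * b i j 1 = 0.
  apply: A2; have := c_antimul i i (E i j 1) (E i j 1).
  rewrite !mxunitM eq_sym (negPf ij) mulr0n mxunit0 addr0 c_zero => ->.
  rewrite (bigD1 j) //= big1 ?addr0 ?mulr2n // => m mj.
  by rewrite (c_row0 i j m 1 mj).1 mul0r addr0.
rewrite -[x]mulr1 -(a_mul i i) // -[y]mulr1 -(b_mul i i) // -mulrA.
by rewrite [a i j 1 * _]mulrA ab1 mul0r mulr0.
Qed.

Lemma b_mul_a i j x y : i != j -> b i j y * a i j x = 0.
Proof.
move=> ij; have ji : j != i by rewrite eq_sym.
have ba1 : b i j 1 * a i j 1 = 0.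
  apply: A2; have := c_antimul j j (E i j 1) (E i j 1).
  rewrite !mxunitM eq_sym (negPf ij) mulr0n mxunit0 addr0 c_zero => ->.
  rewrite (bigD1 i) //= big1 ?addr0 ?mulr2n // => m mi.
  by rewrite (c_row0 j i m 1 mi).2 mul0r addr0.
rewrite -[x]mul1r -(a_mul i j) // -[y]mul1r -(b_mul i j) // -mulrA.
by rewrite [b i j 1 * _]mulrA ba1 mul0r mulr0.
Qed.

Lemma diag1 k : a k k 1 = g k.
Proof. by rewrite /a /c !g_idem. Qed.

(** * The idempotents [f k] *)

Let f k := a k (ord_other k) 1 * a (ord_other k) k 1.

(** With [j = ord_other k], [a k j] factors as [a k m] times [a m j], and [a m j] times [a j k] is
    [a m k]. *)
Lemma f_eq k m : k != m -> f k = a k m 1 * a m k 1.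
Proof.
move=> km; rewrite /f; set j := ord_other k.
have jk : j != k := ord_other_neq k; have kj : k != j by rewrite eq_sym.
have mk : m != k by rewrite eq_sym.
by rewrite -[1]mulr1 -(a_mul k m) // -mulrA a_mul // !mulr1.
Qed.

Lemma f_eqb k m : k != m -> f k = g k - b m k 1 * b k m 1.
Proof.
by move=> km; rewrite -diag1 -[1]mulr1 (diag_mul k m) // !mulr1 addrK -f_eq.
Qed.

Lemma f_mul_g k : f k * g k = f k.
Proof. by rewrite /f /a -mulrA c_mul_g. Qed.

Lemma g_mul_f k : g k * f k = f k.
Proof. by rewrite /f /a mulrA g_mul_c. Qed.

(** Each expression for [f k] suits one part: in [f_eqb] it differs from [g k] by a term that [a]
    annihilates, while in [f_eq] it ends in a factor annihilating [b]. *)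
Lemma f_mul_a k l x : k != l -> f k * a k l x = a k l x.
Proof. by move=> kl; rewrite (f_eqb k l) // mulrBl -mulrA b_mul_a // mulr0 subr0 g_mul_c. Qed.

Lemma a_mul_f k l x : k != l -> a k l x * f l = a k l x.
Proof.
move=> kl; have lk : l != k by rewrite eq_sym.
by rewrite (f_eqb l k) // mulrBr mulrA a_mul_b // mul0r subr0 c_mul_g.
Qed.

Lemma f_mul_b k l x : k != l -> f k * b l k x = 0.
Proof.
move=> kl; have lk : l != k by rewrite eq_sym.
by rewrite (f_eq k l) // -mulrA a_mul_b // mulr0.
Qed.

Lemma b_mul_f k l x : k != l -> b l k x * f l = 0.
Proof.
move=> kl; have lk : l != k by rewrite eq_sym.
by rewrite (f_eq l k) // mulrA b_mul_a // mul0r.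
Qed.

Lemma f_diag k m x y : k != m -> a k k x * a k k y * f k = a k m (x * y) * a m k 1.
Proof.
move=> km; rewrite (f_eq k m) // mulrA -(mulrA (a k k x)).
by rewrite (a_mul k k m) // (a_mul k k m) // mulr1.
Qed.

Lemma diag_f k m x : k != m -> a k k x * f k = a k m x * a m k 1.
Proof. by move=> km; rewrite (f_eq k m) // mulrA a_mul // mulr1. Qed.

(** On the diagonal, the scalar passes from the right factor of [f l] to the left one through
    [a j j x], with [j = ord_other l]. *)
Lemma f_comm_a k l x : f k * a k l x = a k l x * f l.
Proof.
have [->|kl] := eqVneq k l; last by rewrite f_mul_a ?a_mul_f.
have lj : l != ord_other l by rewrite eq_sym ord_other_neq.
rewrite (diag_f _ _ _ lj) (f_eq _ _ lj) -mulrA a_mul; last by rewrite eq_sym.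
have -> : a (ord_other l) l (1 * x) = a (ord_other l) (ord_other l) x * a (ord_other l) l 1.
  by rewrite a_mul ?ord_other_neq // mul1r mulr1.
by rewrite mulrA a_mul // mul1r.
Qed.

Lemma f_idem k : f k * f k = f k.
Proof.
have kj : k != ord_other k by rewrite eq_sym ord_other_neq.
by rewrite [X in _ * X](f_eq _ _ kj) mulrA f_mul_a // -f_eq.
Qed.

Lemma c_split k l X : k != l -> c k l X = a k l (X k l) + b l k (X l k).
Proof.
move=> kl; have lk : l != k by rewrite eq_sym.
rewrite /a /b -cD; apply: c_eq; rewrite mxE !mxunitE !eqxx ?(negPf kl) ?(negPf lk).
  by rewrite addr0.
by rewrite add0r.
Qed.

Lemma c_diag k X : c k k X = a k k (X k k).
Proof. by apply: c_eq; rewrite mxunitE !eqxx. Qed.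

Lemma f_mul_c k l X : f k * c k l X = f k * a k l (X k l).
Proof.
have [->|kl] := eqVneq k l; first by rewrite c_diag.
by rewrite c_split // mulrDr f_mul_b // addr0.
Qed.

Lemma c_mul_f k l X : c k l X * f l = f k * a k l (X k l).
Proof.
have [->|kl] := eqVneq k l; first by rewrite c_diag f_comm_a.
by rewrite c_split // mulrDl b_mul_f ?addr0 ?f_comm_a.
Qed.

(** The factor [f k] extends [a_mul] to [k = l], because it kills the [b] term of [diag_mul]. When
    all indices agree, the product is routed through [ord_other k]. *)
Lemma f_a_mul k m l x y :
  f k * a k m x * (f m * a m l y) = f k * a k l (x * y).
Proof.
rewrite mulrA -[f k * _ * f m]mulrA -f_comm_a mulrA f_idem.
have [<-{l}|kl] := eqVneq k l; last by rewrite -mulrA a_mul.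
have [<-{m}|km] := eqVneq k m; last first.
  rewrite -mulrA [in RHS](diag_mul k m) // mulrDr.
  by rewrite [f k * (b _ _ _ * _)]mulrA f_mul_b // mul0r addr0.
have kj : k != ord_other k by rewrite eq_sym ord_other_neq.
rewrite [RHS]f_comm_a (diag_f _ _ _ kj) -f_diag // f_comm_a -[LHS]mulrA f_comm_a.
by rewrite mulrA.
Qed.

Definition hom_idem : A := \sum_k f k.

Lemma hom_idem_unit : hom_idem * p = hom_idem /\ p * hom_idem = hom_idem.
Proof.
rewrite mulr_suml mulr_sumr; split; apply: eq_bigr => k _.
  by rewrite -{1}f_mul_g -mulrA pr f_mul_g.
by rewrite -{1}g_mul_f mulrA pl g_mul_f.
Qed.

Lemma f_orth k l : k != l -> f k * f l = 0.
Proof.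
move=> kl; rewrite -f_mul_g -(g_mul_f l) -mulrA [g k * _]mulrA.
by rewrite g_orth // mul0r mulr0.
Qed.

Lemma hom_idem_idem : hom_idem * hom_idem = hom_idem.
Proof.
rewrite {1}/hom_idem mulr_suml; apply: eq_bigr => k _.
rewrite mulr_sumr (bigD1 k) //= big1 ?addr0 ?f_idem // => l lk.
by rewrite f_orth // eq_sym.
Qed.

Lemma hom_idemM (z : A) : z * p = z ->
  hom_idem * z = \sum_k \sum_l f k * (g k * z * g l).
Proof.
move=> zp; rewrite mulr_suml; apply: eq_bigr => k _.
by rewrite -mulr_sumr -mulr_sumr sum_g -[g k * z * p]mulrA zp [f k * (g k * z)]mulrA f_mul_g.
Qed.

Lemma hom_idem_psi X : hom_idem * psi X = \sum_k \sum_l f k * a k l (X k l).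
Proof.
rewrite hom_idemM ?pr //; apply: eq_bigr => k _; apply: eq_bigr => l _.
exact: f_mul_c.
Qed.

Lemma hom_idem_comm X : hom_idem * psi X = psi X * hom_idem.
Proof.
rewrite hom_idem_psi -[psi X in RHS]pl -sum_g exchange_big mulr_sumr /=.
apply: eq_bigr => l _; rewrite mulr_suml mulr_suml; apply: eq_bigr => k _.
by rewrite -c_mul_f /c -[_ * f l]mulrA g_mul_f.
Qed.

Lemma hom_idem_mul X Y : hom_idem * psi (X * Y) = hom_idem * (psi X * psi Y).
Proof.
rewrite hom_idem_psi hom_idemM -?mulrA ?pr //.
apply: eq_bigr => k _; apply: eq_bigr => l _.
rewrite c_mul mulr_sumr -mulmxE mxE.
have -> : f k * a k l (\sum_j X k j * Y j l) = \sum_j f k * a k l (X k j * Y j l).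
  rewrite -mulr_sumr; congr (_ * _); apply: (big_morph (a k l)) => [x y|].
    by rewrite /a -cD -mxunitD.
  by rewrite /a /E mxunit0 c_zero.
apply: eq_bigr => m _; rewrite -(f_a_mul k m l) -(f_mul_c k m) -(f_mul_c m l).
rewrite [LHS]mulrA [RHS]mulrA.
by rewrite -[f k * _ * f m]mulrA c_mul_f [f k * (f k * _)]mulrA f_idem -f_mul_c.
Qed.

(* The right-hand side is [hom_idem] computed in the converse ring. *)
Lemma hom_idem_compl :
  p - hom_idem = \sum_k b (ord_other k) k 1 * b k (ord_other k) 1.
Proof.
rewrite -sum_g /hom_idem -sumrB; apply: eq_bigr => k _.
by rewrite (f_eqb k (ord_other k)) ?subKr // eq_sym ord_other_neq.
Qed.

End JordanMap.

(** * The antihomomorphic part *)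

Section Converse.
Variables (F : fieldType) (char_neq2 : 2%N \notin [pchar F]).
Variables (n : nat) (n_ge2 : (2 <= n)%N).
Variables (A : pzRingType) (A2 : forall x : A, x *+ 2 = 0 -> x = 0).
Variable psi : 'M[F]_n -> A.
Hypothesis psi0 : psi 0 = 0.
Hypothesis psiJ : forall X Y W, X * Y + Y * X = W *+ 2 ->
  psi X * psi Y + psi Y * psi X = psi W *+ 2.

Let psi_conv : 'M[F]_n -> A^c := psi.

Lemma psi_convJ X Y W : X * Y + Y * X = W *+ 2 ->
  psi_conv X * psi_conv Y + psi_conv Y * psi_conv X = psi_conv W *+ 2.
Proof. by move=> /psiJ; rewrite addrC. Qed.

(** Passing to the converse ring exchanges [a] and [b]. *)
Lemma hom_idem_conv :
  hom_idem F n A^c psi_conv n_ge2 = psi 1 - hom_idem F n A psi n_ge2 :> A.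
Proof.
rewrite (hom_idem_compl F char_neq2 n A A2 psi psi0 psiJ n_ge2).
apply: eq_bigr => k _.
by apply: (congr2 (@GRing.mul A)); apply: (@mulrA A).
Qed.

(** This is [hom_idem_mul] in the converse ring, read backwards; the idempotent moves to the left
    because it commutes with [psi]. *)
Lemma antihom_idem_mul X Y :
  let f := psi 1 - hom_idem F n A psi n_ge2 in
  f * psi (X * Y) = f * (psi Y * psi X).
Proof.
move=> f; rewrite /f -hom_idem_conv.
have A2c : forall x : A^c, x *+ 2 = 0 -> x = 0 := A2.
set f' : A := hom_idem F n A^c psi_conv n_ge2.
have M : psi (X * Y) * f' = (psi Y * psi X) * f' :=
  hom_idem_mul F char_neq2 n A^c A2c psi_conv psi0 psi_convJ n_ge2 X Y.
have C Z : f' * psi Z = psi Z * f' :=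
  esym (hom_idem_comm F char_neq2 n A^c A2c psi_conv psi0 psi_convJ n_ge2 Z).
by rewrite C M -mulrA -C mulrA -C mulrA.
Qed.

End Converse.

(** * Corners *)

From mathcomp Require Import classical_sets.
Local Open Scope classical_set_scope.

Section Corners.
Variables (A : pzRingType) (q : A).

Lemma corner_mem x : q * x = x -> x * q = x -> corner q x.
Proof. by move=> qx xq; exists x; rewrite ?qx. Qed.

Lemma corner_unit x : is_idempotent q -> corner q x -> q * x = x /\ x * q = x.
Proof. by move=> qq [y _ <-]; rewrite !mulrA qq -!mulrA qq. Qed.

Lemma corner_generated_closed (S : set A) : let B := corner_generated q S in
  [/\ forall x, S x -> B x,
      B 0,
      forall x y, B x -> B y -> B (x + y)
    & forall x y, B x -> B y -> B (x * y)].
Proof.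
split=> [x Sx M [_ SM]|M [[_ Mq MB _] _]|x y Bx By M PM|x y Bx By M PM]; first exact: SM.
  by rewrite -(subrr q); apply: MB.
  have [[_ Mq MB _] _] := PM; have M0 : M 0 by rewrite -(subrr q); apply: MB.
  rewrite -[y]opprK -[- y]sub0r; apply: (MB); first exact: Bx PM.
  by apply: MB => //; apply: By PM.
by have [[_ _ _ MM] _] := PM; apply: MM; [exact: Bx PM | exact: By PM].
Qed.

(** The corner elements commuting with [f] form a corner subring, which contains the generated one
    as soon as it contains [S]. *)
Lemma corner_centralizer (S : set A) f x : is_idempotent q ->
  S `<=` corner q -> f * q = q * f -> (forall y, S y -> f * y = y * f) ->
  corner_generated q S x -> f * x = x * f.
Proof.
move=> qq Sq fq Sf.
pose C := [set y | corner q y /\ f * y = y * f].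
suff CC : corner_subring q C by move=> /(smallest_sub CC)[]// y Sy; split; auto.
split=> [y []//||y z [qy fy] [qz fz]|y z [qy fy] [qz fz]].
- by split=> //; apply: corner_mem.
- have [qy1 qy2] := corner_unit y qq qy; have [qz1 qz2] := corner_unit z qq qz.
  split; last by rewrite mulrBr mulrBl fy fz.
  by apply: corner_mem; rewrite ?mulrBr ?mulrBl ?qy1 ?qy2 ?qz1 ?qz2.
- have [qy1 qy2] := corner_unit y qq qy; have [qz1 qz2] := corner_unit z qq qz.
  split; last by rewrite mulrA fy -mulrA fz mulrA.
  by apply: corner_mem; [rewrite mulrA qy1 | rewrite -mulrA qz2].
Qed.

End Corners.

(** * Decomposition of Jordan multiplicative maps *)

Theorem theorem1p2 (F : fieldType) (char_neq2 : 2%N \notin [pchar F])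
  (n : nat) (n_ge2 : (2 <= n)%N)
  (A : pzRingType) (sigma : {rmorphism dyadic -> A})
  (sigma_central : central_morphism sigma)
  (phi : 'M[F]_n -> A) (phi_jordan : jordan_multiplicative sigma phi) :
  let e := phi 0 in
  let psi := fun X : 'M[F]_n => phi X - e in
  let p := psi 1%:M in
  [/\ is_idempotent e,
      forall X, corner (1 - e) (psi X),
      is_idempotent p /\ (forall X, corner p (psi X))
    & exists f : A,
      let B := corner_generated p (range psi) in
      let theta := fun X => f * psi X in
      let eta := fun X => (p - f) * psi X in
      [/\ [/\ B f, is_idempotent f & forall b, B b -> f * b = b * f],
          corner_hom f theta,
          corner_antihom (p - f) eta,
          forall X, psi X = theta X + eta X
        & forall X, phi X = e + theta X + eta X]].
Proof.
have h2 : sigma Defs.half *+ 2 = 1.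
  rewrite -rmorphMn /= (_ : Defs.half *+ 2 = 1) ?rmorph1 //.
  by apply: val_inj; apply/eqP.
have A2 (x : A) : x *+ 2 = 0 -> x = 0.
  by move=> x2; rewrite -[x]mul1r -h2 mulrnAl -mulrnAr x2 mulr0.
have phiJ X Y W : X * Y + Y * X = W *+ 2 ->
    phi X * phi Y + phi Y * phi X = phi W *+ 2.
  move/(jordan_def F char_neq2 n) <-.
  by rewrite phi_jordan /alg_jordan -mulrnAl h2 mul1r.
move=> e psi p.
have ee : e * e = e.
  by apply: (mulr2n_inj A A2); rewrite {1}mulr2n (phiJ 0 0 0) // mulr0 addr0 mul0rn.
have [e_psi psi_e] : (forall X, e * psi X = 0) /\ (forall X, psi X * e = 0).
  suff epsi X : e * psi X = 0 /\ psi X * e = 0 by split=> X; case: (epsi X).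
  (* From [0 o X = 0] one gets [e o phi X = e], hence [e o psi X = 0]. *)
  apply: (idem_jordan0 A A2) => //; rewrite mulrBr mulrBl addrACA -opprD ee.
  by rewrite (phiJ 0 X 0) ?mul0r ?mulr0 ?addr0 ?mul0rn // -mulr2n subrr.
have psi0 : psi 0 = 0 by exact: subrr.
have phiE X : phi X = psi X + e by rewrite subrK.
have psiJ X Y W : X * Y + Y * X = W *+ 2 ->
    psi X * psi Y + psi Y * psi X = psi W *+ 2.
  (* The cross terms vanish by orthogonality of [e] and [psi]; the summand [2 e] on both sides then
     cancels. *)
  move=> /phiJ; clearbody psi; rewrite (phiE X) (phiE Y) (phiE W).
  rewrite !mulrDl !mulrDr !(e_psi, psi_e) ee !addr0 !add0r.
  by rewrite addrACA -mulr2n mulrnDl => /addIr.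
have pE : psi 1 = p by [].
clearbody psi.
have pl X : p * psi X = psi X := (psi1_unit F n A A2 psi psiJ X).1.
have pr X : psi X * p = psi X := (psi1_unit F n A A2 psi psiJ X).2.
have pp : p * p = p by exact: pl.
pose f := hom_idem F n A psi n_ge2.
have ff : f * f = f := hom_idem_idem F char_neq2 n A A2 psi psi0 psiJ n_ge2.
have fp : f * p = f := (hom_idem_unit F n A A2 psi psiJ n_ge2).1.
have pf : p * f = f := (hom_idem_unit F n A A2 psi psiJ n_ge2).2.
have fC X : f * psi X = psi X * f :=
  hom_idem_comm F char_neq2 n A A2 psi psi0 psiJ n_ge2 X.
have fM X Y : f * psi (X * Y) = f * (psi X * psi Y) :=
  hom_idem_mul F char_neq2 n A A2 psi psi0 psiJ n_ge2 X Y.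
have f'M X Y : (p - f) * psi (X * Y) = (p - f) * (psi Y * psi X) :=
  antihom_idem_mul F char_neq2 n n_ge2 A A2 psi psi0 psiJ X Y.
have psi_add X Y : psi (X + Y) = psi X + psi Y :=
  psiD F char_neq2 n A A2 psi psi0 psiJ n_ge2 X Y.
pose f' := p - f.
have f'f' : f' * f' = f' by rewrite /f' mulrBl !mulrBr pp ff fp pf subrr subr0.
have f'C X : f' * psi X = psi X * f' by rewrite /f' mulrBl mulrBr pl pr fC.
(* Stated for any idempotent commuting with the image, to serve [f] and [p - f] alike. *)
have hom_corner (q : A) : q * q = q -> (forall X, q * psi X = psi X * q) ->
    forall X, corner q (q * psi X).
  by move=> qq qC X; apply: corner_mem; rewrite ?mulrA ?qq // -mulrA -qC mulrA qq.
have hom_prod (q : A) : q * q = q -> (forall X, q * psi X = psi X * q) ->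
    forall X Y, q * psi X * (q * psi Y) = q * (psi X * psi Y).
  by move=> qq qC X Y; rewrite -mulrA [psi X * _]mulrA -qC !mulrA qq.
have psi_corner X : corner p (psi X) by apply: corner_mem.
split=> //.
  by move=> X; apply: corner_mem; rewrite ?mulrBl ?mulrBr ?mul1r ?mulr1 ?e_psi ?psi_e subr0.
exists f; split.
- split=> //.
    have [Bpsi B0 BD BM] := corner_generated_closed A p (range psi).
    have Bp X : corner_generated p (range psi) (psi X) by apply: Bpsi; exists X.
    by rewrite /f /hom_idem; apply: big_ind => // k _; do !apply: (BM).
  move=> b; apply: (corner_centralizer A p (range psi)) => //.
  + by move=> _ [X _ <-].
  + by rewrite fp pf.
  by move=> _ [X _ <-].
- split=> [|X Y|X Y|]; first exact: hom_corner.
  + by rewrite psi_add mulrDr.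
  + by rewrite fM hom_prod.
  + by rewrite pE fp.
- split=> [|X Y|X Y|]; first exact: hom_corner.
  + by rewrite psi_add mulrDr.
  + by rewrite f'M hom_prod.
  + by rewrite pE mulrBl pp fp.
- by move=> X; rewrite -mulrDl addrC subrK pl.
by move=> X; rewrite -addrA -mulrDl [f + _]addrC subrK pl phiE addrC.
Qed.
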